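(* Let $R=(X,s)$ be a rack. If $R$ is not self-dual, then $R$ has no good involutions.
   Context: A rack is a pair $R=(X,s)$ where $X$ is a nonempty set and $s:X\to S_X$, $x\mapsto s_x$, is a map to the symmetric group of $X$ with $s_xs_y=s_{s_x(y)}s_x$ for all $x,y\in X$. An antiautomorphism of $R$ is a permutation $\rho\in S_X$ with $\rho s_x=s_{\rho(x)}^{-1}\rho$ for all $x\in X$ (equivalently, a rack isomorphism from $R$ to its dual rack $(X,x\mapsto s_x^{-1})$). $R$ is self-dual if it has at least one antiautomorphism. A good involution of $R$ is a map $\rho:X\to X$ with $\rho^2=\mathrm{id}_X$ (the identity is allowed) such that $\rho s_x=s_x\rho$ and $s_{\rho(x)}=s_x^{-1}$ for all $x\in X$. *)

(* Defs.v *)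
From mathcomp Require Import ssreflect ssrfun ssrbool.

Set Implicit Arguments.
Unset Strict Implicit.
Unset Printing Implicit Defensive.

(* Elements of the symmetric group of a type X that may be infinite (MathComp's
   {perm T} requires a finType). The inverse is carried as data; it is
   determined by the underlying map. Equality in the symmetric group is
   rendered as pointwise equality =1 of the underlying maps. *)
Record permutation (X : Type) := Permutation {
  perm_fun :> X -> X;
  perm_inv : X -> X;
  perm_funK : cancel perm_fun perm_inv;
  perm_invK : cancel perm_inv perm_fun
}.

Definition permutation_inverse (X : Type) (p : permutation X) : permutation X :=
  Permutation (perm_invK p) (perm_funK p).

Record rack := Rack {
  rack_sort :> Type;
  rack_nonempty : inhabited rack_sort;
  rack_perm : rack_sort -> permutation rack_sort;
  rack_law : forall x y : rack_sort,
    rack_perm x \o rack_perm y =1 rack_perm (rack_perm x y) \o rack_perm x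
}.

Definition antiautomorphism (R : rack) (rho : permutation R) : Prop :=
  forall x : R,
    rho \o rack_perm x =1 permutation_inverse (rack_perm (rho x)) \o rho.

Definition self_dual (R : rack) : Prop :=
  exists rho : permutation R, antiautomorphism rho.

Definition good_involution (R : rack) (rho : R -> R) : Prop :=
  [/\ involutive rho,
      forall x : R, rho \o rack_perm x =1 rack_perm x \o rho
    & forall x : R, rack_perm (rho x) =1 permutation_inverse (rack_perm x)].

(* Main.v *)
(** A good involution is itself an antiautomorphism: it commutes with [s_x],
    and [s_x] is the inverse of [s_(rho x)]. *)
Require Import Defs.
From mathcomp Require Import ssreflect ssrfun ssrbool.

(** By contraposition: an involution is a permutation with itself as inverse, and inverting
    [s_(rho x) = s_x^-1] turns [rho s_x = s_x rho] into the antiautomorphism law, so a good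
    involution witnesses self-duality. *)

Lemma good_involution_antiautomorphism (R : rack) (rho : R -> R)
    (rhoK : involutive rho) :
  good_involution rho -> antiautomorphism (Permutation rhoK rhoK).
Proof.
case=> _ rho_comm rho_inv x y /=.
have /= -> := rho_comm x y.
(* Moving [s_(rho x)] to the left lets its formula be used as given, at the point [s_x (rho y)],
   with no need to invert a pointwise equality. *)
apply: (canRL (perm_funK (rack_perm (rho x)))).
by rewrite rho_inv /= perm_funK.
Qed.

Theorem corollary4p4 (R : rack) (hR : ~ self_dual R) :
  ~ (exists rho : R -> R, good_involution rho).
Proof.
case=> rho rho_good; apply: hR.
have [rhoK _ _] := rho_good.
by exists (Permutation rhoK rhoK); apply: good_involution_antiautomorphism.
Qed.
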